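(* Let $G$ be a graph and $\theta$ a real number, and let $Q_1,\dots,Q_m$ be the components of $G\setminus A_\theta(G)$ with $\mathrm{mult}(\theta,Q_j)=0$. For distinct vertices $u,v$, the pair $\{u,v\}$ is an edge of $D_\theta(G)$ (i.e. $\mathrm{mult}(\theta,G\setminus\{u,v\})\le\mathrm{mult}(\theta,G)$) if and only if one of the following holds: (a) $u\in B_\theta(G)$ or $v\in B_\theta(G)$; (b) $u,v\in N_\theta(G)$ with $u\in V(Q_{j_1})$, $v\in V(Q_{j_2})$ for some $j_1\neq j_2$; (c) $u,v\in V(Q_{j_0})$ for some $j_0$ and $\mathrm{mult}(\theta,Q_{j_0}\setminus\{u,v\})=0$.
   Context: All graphs are finite and simple. For a graph $G$ on $n$ vertices, let $p(G,r)$ be the number of $r$-matchings of $G$ ($p(G,0)=1$); the matching polynomial is $\mu(G,x)=\sum_{r=0}^{\lfloor n/2\rfloor}(-1)^r p(G,r)x^{n-2r}$. For real $\theta$, $\mathrm{mult}(\theta,G)$ is the multiplicity of $\theta$ as a root of $\mu(G,x)$ (it is $0$ if $\theta$ is not a root). $G\setminus X$ denotes deletion of the vertex set $X$; $G\setminus u=G\setminus\{u\}$. A vertex $u$ is $\theta$-essential, $\theta$-neutral, or $\theta$-positive in $G$ according as $\mathrm{mult}(\theta,G\setminus u)$ equals $\mathrm{mult}(\theta,G)-1$, $\mathrm{mult}(\theta,G)$, or $\mathrm{mult}(\theta,G)+1$. A vertex is $\theta$-special if it is not $\theta$-essential but is adjacent to a $\theta$-essential vertex. $B_\theta(G)$,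 $A_\theta(G)$, $N_\theta(G)$ are the sets of $\theta$-essential, $\theta$-special, $\theta$-neutral vertices. A connected graph is $\theta$-critical if all its vertices are $\theta$-essential in it; every component of $G\setminus A_\theta(G)$ is either $\theta$-critical or has $\mathrm{mult}(\theta,\cdot)=0$. The graph $D_\theta(G)$ has vertex set $V(G)$, and distinct $x,y$ are adjacent in $D_\theta(G)$ iff $\mathrm{mult}(\theta,G\setminus\{x,y\})\le\mathrm{mult}(\theta,G)$. *)

(* Defs.v *)
From HB Require Import structures.
From mathcomp Require Import all_boot all_order all_algebra.
Set Implicit Arguments. Unset Strict Implicit. Unset Printing Implicit Defensive.
Import Order.TTheory GRing.Theory Num.Theory.

(* A finite simple graph: vertex type T : finType, adjacency e : rel T,
   assumed symmetric and irreflexive in the theorem.  Subgraphs obtained by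
   vertex deletion are represented by their vertex set S : {set T}
   (the induced subgraph G[S]); G \ X is G[~: X]. *)

Section MatchPoly.
Variables (T : finType) (e : rel T).

Definition is_matching (S : {set T}) (M : {set {set T}}) : bool :=
  [forall P in M, exists x, exists y,
      [&& x \in S, y \in S, e x y & P == [set x; y]]] &&
  [forall P in M, forall Q in M, (P != Q) ==> [disjoint P & Q]].

Definition nmatch (S : {set T}) (r : nat) : nat :=
  #|[set M : {set {set T}} | is_matching S M && (#|M| == r)]|.

Definition matchpoly (R : nzRingType) (S : {set T}) : {poly R} :=
  \sum_(r < (#|S| %/ 2).+1)
     ((-1) ^+ r * (nmatch S r)%:R) *: 'X^(#|S| - 2 * r).

Definition mult (R : fieldType) (theta : R) (S : {set T}) : nat :=
  mup theta (matchpoly R S).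

Definition erest (S : {set T}) : rel T :=
  [rel x y | [&& x \in S, y \in S & e x y]].
Definition comp_of (S : {set T}) (x : T) : {set T} :=
  [set y in S | connect (erest S) x y].
Definition is_comp (S C : {set T}) : Prop :=
  exists2 x, x \in S & C = comp_of S x.

Variables (R : fieldType) (theta : R).

Definition multG : nat := mult theta [set: T].

Definition essential (u : T) : bool := (mult theta [set~ u]).+1 == multG.
Definition neutral (u : T) : bool := mult theta [set~ u] == multG.
Definition positive (u : T) : bool := mult theta [set~ u] == multG.+1.

Definition Bset : {set T} := [set u | essential u].
Definition Aset : {set T} :=
  [set u | ~~ essential u && [exists w, essential w && e u w]].
Definition Nset : {set T} := [set u | neutral u].

Definition Dedge (x y : T) : bool :=
  (x != y) && (mult theta (~: [set x; y]) <= multG)%N.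

End MatchPoly.

(* Main.v *)
Require Import Defs.
From HB Require Import structures.
From mathcomp Require Import all_boot all_order all_algebra.
From mathcomp Require Import zify ring.
Set Implicit Arguments. Unset Strict Implicit. Unset Printing Implicit Defensive.
Import Order.TTheory GRing.Theory Num.Theory.
Local Open Scope ring_scope.

(** The recurrence mu(G) = x mu(G - u) - sum_(w ~ u) mu(G - u - w) turns both
    the Wronskian of mu(G) and mu(G - u) and the Heilmann-Lieb expression
    mu(G - u) mu(G - v) - mu(G) mu(G - u - v) into sums of squares, so that
    their order of vanishing at theta is even, with positive leading
    coefficient.  The first gives interlacing, the second parity constraints on
    the multiplicities; the second also holds after a constant perturbation of
    the weight of one vertex.  From these, special vertices are positive, and
    deleting a special vertex raises by one the multiplicity of G - x for every
    other vertex x (stability).  Moreover a special vertex stays special when a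
    nonessential vertex is deleted.

    For nonessential u and v, an edge uv of D therefore forces u and v outside
    A, and deleting A raises the multiplicities of G, G - u, G - v by |A|.  If
    v is nonessential in G - u, the same holds for G - u - v; otherwise uv is
    trivially an edge.  Hence the edge condition can be read off G - A, where
    multiplicities add over components and u, v lie in components with
    multiplicity 0. *)

(** * Orders of vanishing, leading coefficients and local sums of squares at [theta] *)

Section TaylorOrder.
Variables (R : realFieldType) (theta : R).
Implicit Types (p q r : {poly R}) (m n : nat) (c d : R).

Local Notation eps := ('X - theta%:P).

(* [jet p m c]: p vanishes at theta to order at least m and its Taylor
   coefficient of order m there is c, which may be 0. *)
Definition jet p m c := exists2 r, p = eps ^+ m * r & r.[theta] = c.

Lemma eps_exp_neq0 m : eps ^+ m != 0.
Proof. by rewrite expf_neq0 ?polyXsubC_eq0. Qed.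

Lemma jet_inj p m c d : jet p m c -> jet p m d -> c = d.
Proof. by move=> [r -> <-] [s /(mulfI (eps_exp_neq0 m)) -> <-]. Qed.

Lemma jet0 m : jet 0 m 0.
Proof. by exists 0; rewrite ?mulr0 ?horner0. Qed.

Lemma jetD p q m c d : jet p m c -> jet q m d -> jet (p + q) m (c + d).
Proof. by move=> [r -> <-] [s -> <-]; exists (r + s); rewrite ?mulrDr ?hornerD. Qed.

Lemma jetN p m c : jet p m c -> jet (- p) m (- c).
Proof. by move=> [r -> <-]; exists (- r); rewrite ?mulrN ?hornerN. Qed.

Lemma jetB p q m c d : jet p m c -> jet q m d -> jet (p - q) m (c - d).
Proof. by move=> jp jq; apply: jetD => //; apply: jetN. Qed.

Lemma jetM p q m n c d : jet p m c -> jet q n d -> jet (p * q) (m + n) (c * d).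
Proof.
by move=> [r -> <-] [s -> <-]; exists (r * s); rewrite ?hornerM // exprD; ring.
Qed.

Lemma jetMl q p m c : jet p m c -> jet (q * p) m (q.[theta] * c).
Proof. by move=> jp; apply: (@jetM _ _ 0) => //; exists q; rewrite ?expr0 ?mul1r. Qed.

Lemma jet_sum (I : finType) (P : pred I) (F : I -> {poly R}) (c : I -> R) m :
  (forall i, P i -> jet (F i) m (c i)) ->
  jet (\sum_(i | P i) F i) m (\sum_(i | P i) c i).
Proof.
move=> jF; apply: (big_ind2 (fun p c => jet p m c)) => //; first exact: jet0.
by move=> p c1 q c2; apply: jetD.
Qed.

Lemma jet_low p m n c : (n < m)%N -> jet p m c -> jet p n 0.
Proof.
move=> lt_nm [r -> _]; exists (eps ^+ (m - n) * r).
  by rewrite mulrA -exprD subnKC // ltnW.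
by rewrite hornerM horner_exp hornerXsubC subrr expr0n subn_eq0 leqNgt lt_nm mul0r.
Qed.

Lemma jet_eps p m c : jet (eps * p) m.+1 c -> jet p m c.
Proof.
move=> [r]; rewrite exprS -mulrA => /mulfI -> //; last by rewrite polyXsubC_eq0.
by exists r.
Qed.

(** The factor ['X - theta] keeps the order at [m], so that [m = 0] is no exception. *)
Lemma jet_deriv p m c : jet p m c -> jet (eps * p^`()) m (m%:R * c).
Proof.
move=> [r -> <-]; exists (m%:R * r + eps * r^`()).
  rewrite derivM deriv_exp derivXsubC mul1r -mulr_natl.
  by case: m => [|m]; rewrite ?exprS /=; ring.
rewrite hornerD !hornerM hornerXsubC subrr mul0r addr0; congr (_ * _).
by rewrite -polyC_natr hornerC.
Qed.

Lemma jet_mup p : p != 0 -> exists2 c, c != 0 & jet p (mup theta p) c.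
Proof.
move=> p0; have := mup_geq theta (mup theta p) p0.
rewrite leqnn => /esym/dvdpP [r Er].
exists r.[theta]; last by exists r; rewrite // mulrC.
apply/negP => /factor_theorem [s Es].
have := mup_geq theta (mup theta p).+1 p0; rewrite ltnn => /esym/negP [].
by apply/dvdpP; exists s; rewrite {1}Er Es exprS mulrA.
Qed.

Lemma jet_le_mup p m : (m <= mup theta p)%N -> exists c, jet p m c.
Proof.
have [-> _|p0 le_m] := eqVneq p 0; first by exists 0; apply: jet0.
have [c _ jp] := jet_mup p0.
have [lt_m|] := ltnP m (mup theta p); first by exists 0; apply: jet_low jp.
by move=> ge_m; exists c; rewrite (@anti_leq m (mup theta p)) ?le_m.
Qed.

Lemma jet_lt_mup p m : (m < mup theta p)%N -> jet p m 0.
Proof. by move/jet_le_mup => [c]; apply: jet_low. Qed.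

Lemma mup_ge_jet p m c : p != 0 -> jet p m c -> (m <= mup theta p)%N.
Proof. by move=> p0 [r Er _]; rewrite mup_geq // Er dvdp_mulr. Qed.

Lemma mup_gt_jet p m : p != 0 -> jet p m 0 -> (m < mup theta p)%N.
Proof.
move=> p0 jp; rewrite ltn_neqAle (mup_ge_jet p0 jp) andbT.
have [c c0 jc] := jet_mup p0.
by apply: contraNN c0 => /eqP E; apply/eqP/(@jet_inj p m); rewrite // E.
Qed.

(** The coefficient is an explicit expression, so that it can serve as the coefficient function in
    [jet_sum]. *)
Lemma jet_divp p m : (m <= mup theta p)%N -> jet p m (p %/ eps ^+ m).[theta].
Proof.
move=> /jet_le_mup [c [r -> _]]; exists r => //.
by rewrite mulrC mulpK ?eps_exp_neq0.
Qed.

(* A property of sums of squares that is local at theta. *)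
Definition locally_sos p := p = 0 \/ exists m c, 0 < c /\ jet p (m + m) c.

Lemma locally_sos0 : locally_sos 0. Proof. by left. Qed.

Lemma locally_sos_sqr q : locally_sos (q * q).
Proof.
have [->|q0] := eqVneq q 0; first by left; rewrite mul0r.
have [c c0 jq] := jet_mup q0.
right; exists (mup theta q), (c * c); split; last exact: jetM.
by rewrite -expr2 exprn_even_gt0.
Qed.

Lemma locally_sosD p q : locally_sos p -> locally_sos q -> locally_sos (p + q).
Proof.
case=> [-> | [m [c [c0 jp]]]]; first by rewrite add0r.
case=> [-> | [n [d [d0 jq]]]]; first by rewrite addr0; right; exists m, c.
right; have [lt_mn|lt_nm|E] := ltngtP m n.
- exists m, (c + 0); split; first by rewrite addr0.
  by apply: jetD => //; apply: jet_low jq; lia.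
- exists n, (0 + d); split; first by rewrite add0r.
  by apply: jetD => //; apply: jet_low jp; lia.
by exists m, (c + d); split; [apply: addr_gt0 | apply: jetD; rewrite // E].
Qed.

Lemma locally_sosB_sqr p q : locally_sos (p - q * q) -> locally_sos p.
Proof. by move/locally_sosD/(_ (locally_sos_sqr q)); rewrite subrK. Qed.

Lemma locally_sosB_if (b : bool) p q :
  locally_sos (p - (if b then q * q else 0)) -> locally_sos p.
Proof. by case: b; [apply: locally_sosB_sqr | rewrite subr0]. Qed.

Lemma locally_sos_sum (I : finType) (P : pred I) (F : I -> {poly R}) :
  (forall i, P i -> locally_sos (F i)) -> locally_sos (\sum_(i | P i) F i).
Proof.
by move=> sF; apply: big_ind => //; [apply: locally_sos0 | apply: locally_sosD].
Qed.

(** A nonzero [c] occurs only at the exact order of [p], which is even and carries a positive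
    coefficient. *)
Lemma locally_sos_jet p m c : locally_sos p -> jet p m c ->
  [/\ 0 <= c & odd m -> c = 0].
Proof.
case=> [-> | [n [d [d0 jp]]]] jc; first by rewrite (jet_inj jc (jet0 m)).
have [lt_m|lt_m|E] := ltngtP m (n + n)%N.
- by rewrite (jet_inj jc (jet_low lt_m jp)).
- by have := jet_inj jp (jet_low lt_m jc); move: d0 => /[swap] ->; rewrite ltxx.
rewrite E addnn odd_double; split=> //.
by rewrite E in jc; rewrite (jet_inj jc jp) ltW.
Qed.

Lemma locally_sos_odd p m c : locally_sos p -> odd m -> jet p m c -> c = 0.
Proof. by move=> sp om /(locally_sos_jet sp) [_ /(_ om)]. Qed.

Lemma locally_sos_ge0 p m c : locally_sos p -> jet p m c -> 0 <= c.
Proof. by move=> sp /(locally_sos_jet sp) []. Qed.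

End TaylorOrder.

Lemma setD1C (T : finType) (S : {set T}) (a b : T) : S :\ a :\ b = S :\ b :\ a.
Proof. by apply/setP => x; rewrite !inE andbCA. Qed.

Lemma setD1_notin (T : finType) (S : {set T}) (a : T) : a \notin S -> S :\ a = S.
Proof.
move=> aS; apply/setP => x; rewrite !inE.
by case: eqP => [->|//]; rewrite (negbTE aS).
Qed.

(** * Matchings and the recurrences of the matching polynomial *)

Section Recurrence.
Variables (T : finType) (e : rel T).
Hypotheses (e_sym : symmetric e) (e_irr : irreflexive e).
Implicit Types (S : {set T}) (M : {set {set T}}) (P : {set T}) (u v w x y : T).

Lemma edge_neq x y : e x y -> x != y.
Proof. by apply: contraTneq => ->; rewrite e_irr. Qed.

Lemma is_matchingP S M :
  reflect ((forall P, P \in M -> exists x y,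
              [/\ x \in S, y \in S, e x y & P = [set x; y]]) /\
           (forall P Q, P \in M -> Q \in M -> P != Q -> [disjoint P & Q]))
          (is_matching e S M).
Proof.
apply: (iffP andP) => [[/forall_inP pM /forall_inP dM] | [pM dM]].
  split=> [P /pM /existsP[x /existsP[y /and4P[xS yS exy /eqP EP]]] | P Q PM QM].
    by exists x, y.
  by move/forall_inP: (dM _ PM) => /(_ _ QM)/implyP.
split; apply/forall_inP => P PM.
  have [x [y [xS yS exy EP]]] := pM _ PM.
  by apply/existsP; exists x; apply/existsP; exists y; rewrite xS yS exy EP eqxx.
by apply/forall_inP => Q QM; apply/implyP/dM.
Qed.

Lemma matching_card S M : is_matching e S M -> (2 * #|M| <= #|S|)%N.
Proof.
move/is_matchingP => [pM dM].
have tM : trivIset M by apply/trivIsetP.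
have /eqP : #|cover M| = (2 * #|M|)%N.
  rewrite -(eqP tM) mulnC -sum_nat_const; apply: eq_bigr => P /pM.
  by move=> [x [y [_ _ exy ->]]]; rewrite cards2 edge_neq.
rewrite eqn_leq => /andP [_ /leq_trans]; apply; apply/subset_leq_card/subsetP => z.
by move=> /bigcupP [P /pM [x [y [xS yS _ ->]]]]; rewrite !inE => /orP [] /eqP ->.
Qed.

Lemma matching_sub S M P : is_matching e S M -> P \in M -> P \subset S.
Proof.
move=> /is_matchingP [pM _] /pM [x [y [xS yS _ ->]]].
by apply/subsetP => z; rewrite !inE => /orP [] /eqP ->.
Qed.

Lemma matching_avoid S M u :
  is_matching e S M && (u \notin cover M) = is_matching e (S :\ u) M.
Proof.
apply/andP/idP => [[mM uM] | mM].
  have /is_matchingP [pM dM] := mM; apply/is_matchingP; split=> // P PM.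
  have [x [y [xS yS exy EP]]] := pM _ PM; exists x, y.
  have nu z : z \in P -> z != u.
    by move=> zP; apply: contraNneq uM => <-; apply/bigcupP; exists P.
  by split=> //; rewrite !inE ?xS ?yS nu // EP !inE eqxx ?orbT.
split.
  have /is_matchingP [pM dM] := mM; apply/is_matchingP; split=> // P /pM.
  move=> [x [y []]]; rewrite !inE => /andP [_ xS] /andP [_ yS] exy EP.
  by exists x, y.
apply/bigcupP => [[P PM uP]]; have := subsetP (matching_sub mM PM) u uP.
by rewrite !inE eqxx.
Qed.

Lemma matching_add S M u w : w \in S :\ u -> e u w -> u \in S ->
  is_matching e S ([set u; w] |: M) && ([set u; w] \notin M)
    = is_matching e (S :\ u :\ w) M.
Proof.
rewrite !inE => /andP [wu wS] euw uS; apply/andP/idP => [[mM PM] | mM].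
  have /is_matchingP [pM dM] := mM; apply/is_matchingP; split; last first.
    by move=> P Q Pin Qin; apply: dM; rewrite !inE ?Pin ?Qin orbT.
  move=> P Pin; have Pin' : P \in [set u; w] |: M by rewrite !inE Pin orbT.
  have [x [y [xS yS exy EP]]] := pM _ Pin'; exists x, y.
  have dP : [disjoint P & [set u; w]].
    apply: dM => //; first by rewrite !inE eqxx.
    by apply: contraNneq PM => <-.
  have := disjointFr dP; rewrite EP => dP'.
  have := dP' x; have := dP' y; rewrite !inE !eqxx orbT xS yS exy /=.
  move=> /(_ isT)/negbT /norP [/negbTE-> /negbTE->].
  by move=> /(_ isT)/negbT /norP [/negbTE-> /negbTE->].
have avoid Q : Q \in M -> [disjoint [set u; w] & Q].
  move=> QM; rewrite disjoint_sym disjoints_subset.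
  apply: subset_trans (matching_sub mM QM) _.
  by apply/subsetP => z; rewrite !inE negb_or => /and3P [-> ->].
split; last first.
  apply/negP => /avoid; rewrite -setI_eq0 setIid => /eqP/setP/(_ u).
  by rewrite !inE eqxx.
have /is_matchingP [pM dM] := mM; apply/is_matchingP; split.
  move=> P; rewrite !inE => /orP [/eqP -> | PM]; first by exists u, w.
  have [x [y []]] := pM _ PM; rewrite !inE => /and3P [_ _ xS] /and3P [_ _ yS] exy EP.
  by exists x, y.
move=> P Q; rewrite !inE => /orP [/eqP -> | PM] /orP [/eqP -> | QM].
- by rewrite eqxx.
- by move=> _; apply: avoid.
- by move=> _; rewrite disjoint_sym avoid.
by apply: dM.
Qed.

(** The partner is described through [pred1 w] so that a sum over possible partners collapses to one
    term. *)
Lemma matching_partner S M u : is_matching e S M -> u \in cover M ->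
  exists w, (fun v => (v \in S :\ u) && e u v && ([set u; v] \in M)) =1 pred1 w.
Proof.
move=> /is_matchingP [pM dM] /bigcupP [P PM uP].
have [w [EP wS euw]] : exists w, [/\ P = [set u; w], w \in S & e u w].
  have [x [y [xS yS exy EP]]] := pM _ PM.
  move: uP; rewrite EP !inE => /orP [] /eqP ->; first by exists y.
  by exists x; rewrite setUC e_sym.
exists w => v /=; apply/idP/eqP => [/andP [/andP [vS euv] uvM] | ->]; last first.
  by rewrite -EP PM euw !inE wS eq_sym edge_neq.
have [E|N] := eqVneq [set u; v] P.
  have : v \in P by rewrite -E !inE eqxx orbT.
  rewrite EP !inE => /orP [/eqP Evu|/eqP //].
  by move: euv; rewrite Evu e_irr.
have := disjointFr (dM _ _ uvM PM N) (x := u).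
by rewrite uP !inE eqxx => /(_ isT).
Qed.

Variable R : comNzRingType.

Lemma matchpolyE S :
  matchpoly e R S =
  \sum_(M | is_matching e S M) (-1) ^+ #|M| *: 'X^(#|S| - 2 * #|M|).
Proof.
rewrite (partition_big (fun M => inord #|M| : 'I_(#|S| %/ 2).+1) predT) //=.
apply: eq_bigr => r _; rewrite /nmatch -sum1dep_card natr_sum mulr_sumr scaler_suml.
have Er M : is_matching e S M -> (inord #|M| == r) = (#|M| == r).
  move/matching_card => le_M; rewrite -val_eqE /= inordK //.
  by rewrite ltnS leq_divRL // mulnC.
apply: eq_big => [M | M].
  by case mM: (is_matching e S M) => //=; rewrite Er.
by move=> /andP [_ /eqP <-]; rewrite mulr1.
Qed.

Lemma matchpoly_set0 : matchpoly e R set0 = 1.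
Proof.
rewrite /matchpoly cards0 div0n big_ord1 expr0 mul1r expr0.
rewrite /nmatch (_ : [set _ | _] = [set set0]) ?cards1 ?scale1r //.
apply/setP => M; rewrite !inE cards_eq0 andbC; case: eqP => //= ->.
by apply/is_matchingP; split=> P; rewrite !inE.
Qed.

Lemma matchpoly_rec S u : u \in S ->
  matchpoly e R S = 'X * matchpoly e R (S :\ u)
    - \sum_(w in S :\ u | e u w) matchpoly e R (S :\ u :\ w).
Proof.
move=> uS; rewrite !matchpolyE (bigID (fun M => u \notin cover M)) /=.
have cS : #|S| = #|S :\ u|.+1 by rewrite (cardsD1 u S) uS.
congr (_ + _).
  rewrite mulr_sumr (eq_bigl _ _ (fun M => matching_avoid S M u)).
  apply: eq_bigr => M /matching_card le_M.
  by rewrite -scalerAr -exprS cS subSn.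
pose f M : {poly R} := (-1) ^+ #|M| *: 'X^(#|S| - 2 * #|M|).
pose Q M w := (w \in S :\ u) && e u w && ([set u; w] \in M).
(* Each matching covering [u] is counted through its unique partner [w]; exchanging the sums groups
   the matchings by [w]. *)
transitivity (\sum_(M | is_matching e S M && ~~ (u \notin cover M))
                 \sum_(w | Q M w) f M).
  apply: eq_bigr => M /andP [mM]; rewrite negbK => uM.
  have [w Ew] := matching_partner mM uM.
  by rewrite (eq_bigl (pred1 w)) ?big_pred1_eq // => v; apply: Ew.
rewrite (exchange_big_dep (fun w => (w \in S :\ u) && e u w)) /=; last first.
  by move=> M w _ /andP [].
rewrite -sumrN; apply: eq_bigr => w /andP [wS euw].
pose h M := [set u; w] |: M; pose h' M := M :\ [set u; w].
rewrite (reindex_onto h h'); last first.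
  by move=> M /andP [_ /andP [_ uwM]]; rewrite /h /h' setD1K.
rewrite matchpolyE -sumrN; apply: eq_big => [M | M].
  rewrite -matching_add // /Q wS euw /h /h' !inE eqxx /= andbT negbK.
  have -> : (u \in cover ([set u; w] |: M)) = true.
    by apply/bigcupP; exists [set u; w]; rewrite !inE eqxx.
  rewrite andbT; congr (_ && _); apply/eqP/idP => [<- | nM]; first by rewrite !inE eqxx.
  by rewrite setU1K.
move=> /andP [/andP [/andP [mM _] _] /eqP E].
have nM : [set u; w] \notin M by rewrite -E /h' !inE eqxx.
rewrite /f /h cardsU1 nM add1n exprS mulN1r scaleNr; congr (- (_ *: 'X^_)).
by rewrite cS (cardsD1 w (S :\ u)) wS; lia.
Qed.

(** Expand at a vertex of [S1]: it has no neighbour in [S2], so [S2] stays intact in every term and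
    induction applies. *)
Lemma matchpolyU S1 S2 : [disjoint S1 & S2] ->
  (forall x y, x \in S1 -> y \in S2 -> ~~ e x y) ->
  matchpoly e R (S1 :|: S2) = matchpoly e R S1 * matchpoly e R S2.
Proof.
have [n] := ubnP #|S1|; elim: n S1 => // n IHn S1 lt_n dS nE.
have [-> | [u uS1]] := set_0Vmem S1; first by rewrite set0U matchpoly_set0 mul1r.
have nuS2 : u \notin S2 by rewrite (disjointFr dS).
have cS : #|S1| = #|S1 :\ u|.+1 by rewrite (cardsD1 u S1) uS1.
have E w : w \notin S2 -> forall S, (S :|: S2) :\ w = (S :\ w) :|: S2.
  move=> wS2 S; apply/setP => x; rewrite !inE.
  by case: (eqVneq x w) => [->|] //=; rewrite (negbTE wS2).
have sub S : S \subset S1 :\ u ->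
    matchpoly e R (S :|: S2) = matchpoly e R S * matchpoly e R S2.
  move=> sS; have sS1 : S \subset S1 by apply: subset_trans sS (subD1set _ _).
  apply: IHn.
  - by have := subset_leq_card sS; lia.
  - exact: disjointWl sS1 dS.
  - by move=> x y /(subsetP sS1); apply: nE.
rewrite (@matchpoly_rec _ u) ?(@matchpoly_rec S1 u) //; last by rewrite !inE uS1.
rewrite mulrBl mulr_suml E // sub // mulrA; congr (_ - _).
apply: eq_big => [w | w /andP [_ euw]].
  rewrite !inE; case wS2: (w \in S2); last by rewrite orbF.
  by rewrite (disjointFl dS wS2) andbF orbT /= (negbTE (nE _ _ uS1 wS2)).
have nwS2 : w \notin S2 by apply: contraL euw; apply: nE.
by rewrite E // sub ?subD1set.
Qed.

(** Differentiate the recurrence at u. By induction and an exchange of sums, the terms belonging to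
    a vertex y other than u form the recurrence at u of mu(S - y). *)
Lemma deriv_matchpoly S :
  (matchpoly e R S)^`() = \sum_(u in S) matchpoly e R (S :\ u).
Proof.
have [n] := ubnP #|S|; elim: n S => // n IHn S lt_n.
have [-> | [u uS]] := set_0Vmem S.
  by rewrite matchpoly_set0 big_set0 -(polyC1 R) derivC.
have cS : #|S| = #|S :\ u|.+1 by rewrite (cardsD1 u S) uS.
rewrite (matchpoly_rec uS) derivB derivM derivX mul1r.
rewrite (big_setD1 u) //= -addrA; congr (_ + _).
rewrite IHn; last lia.
rewrite [X in _ - X]raddf_sum /= mulr_sumr.
rewrite [X in _ - X](eq_bigr (fun w => \sum_(y in S :\ u :\ w)
    matchpoly e R (S :\ u :\ w :\ y))); last first.
  move=> w /andP [wS _]; apply: IHn.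
  by have := subset_leq_card (subD1set (S :\ u) w); lia.
rewrite [X in _ - X](exchange_big_dep (mem (S :\ u))) /=; last first.
  by move=> w y _ /setD1P [].
rewrite -sumrN -big_split /=; apply: eq_bigr => y yS.
have uSy : u \in S :\ y by move: yS; rewrite !inE eq_sym uS => /andP [->].
rewrite (matchpoly_rec uSy) (setD1C S y u); congr (_ - _).
apply: eq_big => [w | w _]; last by rewrite setD1C.
by move: yS; rewrite !inE (eq_sym w y) => ->; rewrite andbT -!andbA; do !bool_congr.
Qed.

End Recurrence.

(** * Sum-of-squares identities, interlacing and parity *)

Section HeilmannLieb.
Variables (T : finType) (e : rel T).
Hypotheses (e_sym : symmetric e) (e_irr : irreflexive e).
Variables (R : realFieldType) (theta : R).
Implicit Types (S : {set T}) (u v w x : T).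

Lemma nbr_sumD1 (f : T -> {poly R}) S u v : v \in S ->
  \sum_(w in S | e u w) f w =
  (if e u v then f v else 0) + \sum_(w in S :\ v | e u w) f w.
Proof. by move=> vS; rewrite big_mkcondr (big_setD1 v) //= -big_mkcondr. Qed.

(* [q] is the matching polynomial for the vertex weights ['X - a u].  The
   square of [q] on the edge uv is the term of the path uv in the
   Heilmann-Lieb sum over all paths from u to v. *)
Lemma weighted_Heilmann_Lieb (q : {set T} -> {poly R}) (a : T -> R) :
  (forall S u, u \in S -> q S = ('X - (a u)%:P) * q (S :\ u)
     - \sum_(w in S :\ u | e u w) q (S :\ u :\ w)) ->
  forall S u v, u \in S -> v \in S -> u != v ->
  locally_sos theta (q (S :\ u) * q (S :\ v) - q S * q (S :\ u :\ v)
     - (if e u v then q (S :\ u :\ v) * q (S :\ u :\ v) else 0)).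
Proof.
move=> recq S; have [n] := ubnP #|S|; elim: n S => // n IHn S lt_n u v uS vS nuv.
have cS : #|S| = #|S :\ u|.+1 by rewrite (cardsD1 u S) uS.
have vSu : v \in S :\ u by rewrite !inE eq_sym nuv.
have uSv : u \in S :\ v by rewrite !inE nuv.
rewrite (recq _ _ uS) (recq _ _ uSv) (setD1C S v u) (nbr_sumD1 _ _ vSu).
set A := 'X - _; set b := q (S :\ u); set c := q (S :\ u :\ v).
set s := \sum_(w in _ | _) _; set t := \sum_(w in _ | _) _.
(* What remains is the sum, over neighbours w of u, of the same expression for S - u and the pair w,
   v. *)
have -> : b * (A * c - s) - (A * b - ((if e u v then c else 0) + t)) * c
            - (if e u v then c * c else 0) = t * c - b * s.
  by case: (e u v); ring.
rewrite /s /t mulr_suml mulr_sumr -sumrB.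
apply: locally_sos_sum => w /andP [wS euw].
have wSu : w \in S :\ u by case/setD1P: wS.
have nwv : w != v by case/setD1P: wS.
have lt_nu : (#|S :\ u| < n)%N by rewrite -ltnS -cS.
have /locally_sosB_if := IHn (S :\ u) lt_nu w v wSu vSu nwv.
by rewrite (setD1C (S :\ u) w v).
Qed.

Local Notation mu := (matchpoly e R).
Local Notation m := (mult e theta).

Lemma matchpoly_Heilmann_Lieb S u v : u \in S -> v \in S -> u != v ->
  locally_sos theta (mu (S :\ u) * mu (S :\ v) - mu S * mu (S :\ u :\ v)
     - (if e u v then mu (S :\ u :\ v) * mu (S :\ u :\ v) else 0)).
Proof.
apply: (@weighted_Heilmann_Lieb mu (fun=> 0)) => {}S {}u uS.
by rewrite subr0 -matchpoly_rec.
Qed.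

Lemma Heilmann_Lieb_sos S u v : u \in S -> v \in S -> u != v ->
  locally_sos theta (mu (S :\ u) * mu (S :\ v) - mu S * mu (S :\ u :\ v)).
Proof.
by move=> uS vS nuv; apply: locally_sosB_if (matchpoly_Heilmann_Lieb uS vS nuv).
Qed.

(** By the recurrence, this difference is the sum of the Wronskians of mu(S - u) and mu(S - u - w)
    over neighbours w of u, so induction applies. *)
Lemma Wronskian_sos S u : u \in S ->
  locally_sos theta ((mu S)^`() * mu (S :\ u) - mu S * (mu (S :\ u))^`()
                       - mu (S :\ u) * mu (S :\ u)).
Proof.
have [n] := ubnP #|S|; elim: n S u => // n IHn S u lt_n uS.
have cS : #|S| = #|S :\ u|.+1 by rewrite (cardsD1 u S) uS.
rewrite (matchpoly_rec e_sym e_irr R uS) derivB derivM derivX mul1r.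
set b := mu (S :\ u); set t := \sum_(w in _ | _) _.
have -> : (b + 'X * b^`() - t^`()) * b - ('X * b - t) * b^`() - b * b
          = b^`() * t - b * t^`() by ring.
rewrite /t [X in _ - _ * X]raddf_sum !mulr_sumr -sumrB.
apply: locally_sos_sum => w /andP [wS euw].
by apply: locally_sosB_sqr (IHn _ _ _ wS); lia.
Qed.

Lemma not_locally_sosN_sqr p : p != 0 -> ~ locally_sos theta (- (p * p)).
Proof.
move=> p0 sp; have [c c0 jp] := jet_mup theta p0.
have := locally_sos_ge0 sp (jetN (jetM jp jp)).
by rewrite oppr_ge0 -expr2 real_exprn_even_le0 ?num_real // (negbTE c0).
Qed.

(** If mu(S) were 0, [Wronskian_sos] would make -mu(S - u)^2 a local sum of squares. *)
Lemma matchpoly_neq0 S : mu S != 0.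
Proof.
have [n] := ubnP #|S|; elim: n S => // n IHn S lt_n.
have [-> | [u uS]] := set_0Vmem S; first by rewrite matchpoly_set0 oner_neq0.
have cS : #|S| = #|S :\ u|.+1 by rewrite (cardsD1 u S) uS.
apply/eqP => S0; have := Wronskian_sos uS.
rewrite S0 deriv0 !mul0r subrr sub0r.
by apply: not_locally_sosN_sqr; apply: IHn; lia.
Qed.

Lemma mult_jet S : exists2 c, c != 0 & jet theta (mu S) (m S) c.
Proof. exact/jet_mup/matchpoly_neq0. Qed.

Lemma multU S1 S2 : [disjoint S1 & S2] ->
  (forall x y, x \in S1 -> y \in S2 -> ~~ e x y) ->
  m (S1 :|: S2) = (m S1 + m S2)%N.
Proof. by move=> dS nE; rewrite /mult matchpolyU // mupM ?matchpoly_neq0. Qed.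

Lemma Wronskian_jet S u i j c d :
  jet theta (mu S) i c -> jet theta (mu (S :\ u)) j d -> (0 < i + j)%N ->
  jet theta ((mu S)^`() * mu (S :\ u) - mu S * (mu (S :\ u))^`()) (i + j).-1
      ((i%:R - j%:R) * (c * d)).
Proof.
move=> jS ju ij; apply: jet_eps; rewrite prednK //.
have := jetB (jetM (jet_deriv jS) ju) (jetM jS (jet_deriv ju)).
by congr jet; ring.
Qed.

(** Otherwise the Wronskian vanishes to higher order than mu(S - u)^2, and the negative square leads
    in [Wronskian_sos]. *)
Lemma mult_leD1 S u : (m S <= (m (S :\ u)).+1)%N.
Proof.
have [uS | uS] := boolP (u \in S); last by rewrite setD1_notin.
rewrite leqNgt; apply/negP => gtm.
have [c c0 jS] := mult_jet S; have [d d0 ju] := mult_jet (S :\ u).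
have jW := Wronskian_jet jS ju (ltac:(lia) : 0 < m S + m (S :\ u))%N.
have /(jet_low (n := m (S :\ u) + m (S :\ u))) := jW => /(_ ltac:(lia)) jW0.
have := locally_sos_ge0 (Wronskian_sos uS) (jetB jW0 (jetM ju ju)).
by rewrite sub0r oppr_ge0 -expr2 real_exprn_even_le0 ?num_real // (negbTE d0).
Qed.

(** By [mult_leD1], every term of the recurrence at u vanishes to order at least m(S - u) - 1. *)
Lemma mult_D1le S u : (m (S :\ u) <= (m S).+1)%N.
Proof.
have [uS | uS] := boolP (u \in S); last by rewrite setD1_notin.
case Em : (m (S :\ u)) => [//|j]; rewrite ltnS.
have [c jS] : exists c, jet theta (mu S) j c.
  have ju : jet theta (mu (S :\ u)) j 0 by apply: jet_lt_mup; rewrite -/(m _) Em.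
  have js w : jet theta (mu (S :\ u :\ w)) j
                  (mu (S :\ u :\ w) %/ ('X - theta%:P) ^+ j).[theta].
    by apply: jet_divp; have := mult_leD1 (S :\ u) w; rewrite Em ltnS.
  eexists; rewrite (matchpoly_rec e_sym e_irr R uS).
  by apply: jetB; [apply: jetMl ju | apply: jet_sum => w _; apply: js].
exact: mup_ge_jet (matchpoly_neq0 S) jS.
Qed.

(** The leading coefficient of the Wronskian is (m(S) - m(S - u)) c d = c d. This sign later
    excludes cancellation in the recurrence. *)
Lemma essential_jet_sign S u c d : u \in S -> (m (S :\ u)).+1 = m S ->
  jet theta (mu S) (m S) c -> jet theta (mu (S :\ u)) (m (S :\ u)) d ->
  c != 0 -> d != 0 -> 0 < c * d.
Proof.
move=> uS Em jS ju c0 d0; rewrite lt_def mulf_neq0 //=.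
have := Wronskian_jet jS ju (ltac:(lia) : 0 < m S + m (S :\ u))%N.
rewrite -Em -natr1 addrAC subrr add0r mul1r.
move=> /locally_sos_ge0; apply.
exact: locally_sosB_sqr (Wronskian_sos uS).
Qed.

(** The Heilmann-Lieb expression has no odd order, so a product of odd order cannot be the one of
    strictly smaller order. *)
Lemma mult_parity S u v : u \in S -> v \in S -> u != v ->
  (odd (m (S :\ u) + m (S :\ v)) -> m S + m (S :\ u :\ v) <= m (S :\ u) + m (S :\ v))%N /\
  (odd (m S + m (S :\ u :\ v)) -> m (S :\ u) + m (S :\ v) <= m S + m (S :\ u :\ v))%N.
Proof.
move=> uS vS nuv; have sF := Heilmann_Lieb_sos uS vS nuv.
have [a a0 ju] := mult_jet (S :\ u); have [b b0 jv] := mult_jet (S :\ v).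
have [c c0 jS] := mult_jet S; have [d d0 juv] := mult_jet (S :\ u :\ v).
have j1 := jetM ju jv; have j2 := jetM jS juv.
split=> odd_m; rewrite leqNgt; apply/negP => lt_m.
  have := locally_sos_odd sF odd_m (jetB j1 (jet_low lt_m j2)).
  by apply/eqP; rewrite subr0 mulf_neq0.
have := locally_sos_odd sF odd_m (jetB (jet_low lt_m j1) j2).
by apply/eqP; rewrite sub0r oppr_eq0 mulf_neq0.
Qed.

(** The odd number is written out so that linear arithmetic can use the statement. *)
Lemma mult_parity1 S u v j : u \in S -> v \in S -> u != v ->
  (m (S :\ u) + m (S :\ v) = (j + j).+1 -> m S + m (S :\ u :\ v) <= (j + j).+1)%N.
Proof.
move=> uS vS nuv E; rewrite -E (mult_parity uS vS nuv).1 //.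
by rewrite E /= addnn odd_double.
Qed.

Lemma mult_parity2 S u v j : u \in S -> v \in S -> u != v ->
  (m S + m (S :\ u :\ v) = (j + j).+1 -> m (S :\ u) + m (S :\ v) <= (j + j).+1)%N.
Proof.
move=> uS vS nuv E; rewrite -E (mult_parity uS vS nuv).2 //.
by rewrite E /= addnn odd_double.
Qed.

End HeilmannLieb.

(** * Essential and special vertices under vertex deletion *)

Section Stability.
Variables (T : finType) (e : rel T).
Hypotheses (e_sym : symmetric e) (e_irr : irreflexive e).
Variables (R : realFieldType) (theta : R).
Implicit Types (S G X : {set T}) (u v w x z : T).
Local Notation mu := (matchpoly e R).
Local Notation m := (mult e theta).

Definition ess S u := (u \in S) && ((m (S :\ u)).+1 == m S).
Definition spec S a :=
  [&& a \in S, ~~ ess S a & [exists w, ess S w && e a w]].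

Lemma specP S a : reflect
  [/\ a \in S, ~~ ess S a & exists w, ess S w /\ e a w] (spec S a).
Proof.
apply: (iffP and3P) => [[aS na /existsP [w /andP [ew eaw]]] | [aS na [w [ew eaw]]]].
  by split=> //; exists w.
by split=> //; apply/existsP; exists w; rewrite ew.
Qed.

Lemma ness_mult S u : u \in S -> ~~ ess S u -> (m S <= m (S :\ u))%N.
Proof.
by move=> uS; rewrite /ess uS /=; have := mult_leD1 e_sym e_irr theta S u; lia.
Qed.

Lemma ness_neq S u w : ~~ ess S u -> ess S w -> u != w.
Proof. by move=> nu; apply: contraTneq => <-. Qed.

(** Interlacing suffices if u is positive; if u is neutral, the sum m(S - u) + m(S - w) is odd and
    parity gives the upper bound. *)
Lemma ess_D1 S u w : u \in S -> ~~ ess S u -> ess S w -> ess (S :\ u) w.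
Proof.
move=> uS nu ew; have nuw := ness_neq nu ew.
have lu := ness_mult uS nu.
case/andP: ew => wS /eqP Ew; rewrite /ess !inE eq_sym nuw wS /=.
have := mult_D1le e_sym e_irr theta (S :\ w) u; rewrite (setD1C S w u).
have := mult_leD1 e_sym e_irr theta (S :\ u) w.
have := mult_D1le e_sym e_irr theta S u.
have := @mult_parity1 _ _ e_sym e_irr _ theta S u w (m (S :\ w)) uS wS nuw.
have [Eu|] := eqVneq (m (S :\ u)) (m S); lia.
Qed.

(** If a were neutral, both products in the Heilmann-Lieb expression would have order above 2 m(S -
    a - w), and the square contributed by the edge aw would leave a negative leading coefficient. *)
Lemma spec_positive S a : spec S a -> m (S :\ a) = (m S).+1.
Proof.
move=> /specP [aS na [w [ew eaw]]]; have naw := ness_neq na ew.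
have la := ness_mult aS na; have /andP [_ /eqP Eaw] := ess_D1 aS na ew.
have /andP [wS /eqP Ew] := ew; have := mult_D1le e_sym e_irr theta S a.
suff : m (S :\ a) != m S by lia.
apply/eqP => Ea; have := matchpoly_Heilmann_Lieb e_sym e_irr theta aS wS naw.
rewrite eaw.
have [c1 _ ja] := mult_jet e_sym e_irr theta (S :\ a).
have [c2 _ jw] := mult_jet e_sym e_irr theta (S :\ w).
have [c3 _ jS] := mult_jet e_sym e_irr theta S.
have [d d0 jaw] := mult_jet e_sym e_irr theta (S :\ a :\ w).
set n := (m (S :\ a :\ w) + m (S :\ a :\ w))%N.
have j1 : jet theta (mu (S :\ a) * mu (S :\ w)) n 0.
  by apply: jet_low (jetM ja jw); rewrite /n; lia.
have j2 : jet theta (mu S * mu (S :\ a :\ w)) n 0.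
  by apply: jet_low (jetM jS jaw); rewrite /n; lia.
move=> /locally_sos_ge0 /(_ (jetB (jetB j1 j2) (jetM jaw jaw))).
by rewrite subr0 sub0r oppr_ge0 -expr2 real_exprn_even_le0 ?num_real //= (negbTE d0).
Qed.

(* The matching polynomial of the graph in which the weight of x has been
   raised by 1: a constant perturbation at a single vertex. *)
Definition perturbed x S := mu S + (if x \in S then mu (S :\ x) else 0).

(** For u other than x, add the recurrences of mu(S) and mu(S - x) at u; for u = x the added mu(S -
    x) turns the weight X into X + 1. *)
Lemma perturbed_rec x S u : u \in S ->
  perturbed x S = ('X - (- (u == x)%:R)%:P) * perturbed x (S :\ u)
    - \sum_(w in S :\ u | e u w) perturbed x (S :\ u :\ w).
Proof.
move=> uS; rewrite /perturbed (matchpoly_rec e_sym e_irr R uS).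
have [<- | nux] := eqVneq u x.
  rewrite uS !inE eqxx /= addr0 polyCN opprK polyC1.
  set s := \sum_(w in _ | _) _; set t := \sum_(w in _ | _) _.
  have -> : t = s by apply: eq_bigr => w _; rewrite !inE eqxx andbF addr0.
  by ring.
rewrite polyCN polyC0 oppr0 subr0 big_split /=.
set s := \sum_(w in _ | _) _; set t := \sum_(w in _ | _) _.
rewrite !inE eq_sym nux /=.
have [xS | nxS] := boolP (x \in S); last first.
  rewrite (_ : t = 0); first by ring.
  by apply: big1 => w _; rewrite !inE (negbTE nxS) !andbF.
have uSx : u \in S :\ x by rewrite !inE nux.
rewrite (matchpoly_rec e_sym e_irr R uSx) (setD1C S x u) (_ : t =
  \sum_(w in S :\ u :\ x | e u w) mu (S :\ u :\ x :\ w)); first by ring.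
rewrite /t (@nbr_sumD1 _ _ _ _ _ u x); last by rewrite !inE eq_sym nux.
rewrite !inE eqxx /= if_same add0r; apply: eq_bigr => w.
rewrite !inE => /andP [/and3P [nwx _ _] _].
by rewrite eq_sym nwx xS (eq_sym x u) nux /= setD1C.
Qed.

(* In the matroid whose bases are the monomials of the lowest homogeneous
   part of the multivariate matching polynomial at theta, this says that
   being parallel is transitive. *)
Lemma parallel_trans G x v w : x \in G -> v \in G -> w \in G ->
  x != v -> x != w -> v != w ->
  (m (G :\ x)).+1 = m G -> (m G <= (m (G :\ x :\ v)).+1)%N ->
  (m G <= (m (G :\ x :\ w)).+1)%N -> (m G <= (m (G :\ v :\ w)).+1)%N.
Proof.
move=> xG vG wG nxv nxw nvw Ex lxv lxw; rewrite leqNgt; apply/negP => gvw.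
have D1 S u := mult_leD1 e_sym e_irr theta S u.
have Dv := D1 G v; have Dw := D1 G w; have Dvw := D1 (G :\ v) w.
have Dwv := D1 (G :\ w) v; rewrite (setD1C G w v) in Dwv.
have vGx : v \in G :\ x by rewrite !inE eq_sym nxv.
have wGx : w \in G :\ x by rewrite !inE eq_sym nxw.
have par := @mult_parity2 _ _ e_sym e_irr _ theta _ _ _ (m (G :\ v :\ w)) vGx wGx nvw.
have Dxvw := D1 (G :\ x :\ v) w.
set j := m (G :\ v :\ w) in par gvw Dvw Dwv.
(* Otherwise m(G - x) + m(G - x - v - w) = 2j + 1, while m(G - x - v) and m(G - x - w) are at least
   j + 1, against parity. *)
have gxvw : (j < m (G :\ x :\ v :\ w))%N.
  by clear -par gvw lxv lxw Dxvw Ex Dvw; lia.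
have [EG gv gw Ejx] :
    [/\ m G = j.+2, j < m (G :\ v), j < m (G :\ w) & m (G :\ x) = j.+1]%N.
  by clear -gvw Dvw Dwv Dv Dw Ex; split; lia.
rewrite EG ltnS in lxv; rewrite EG ltnS in lxw; clear par gvw Dvw Dwv Dv Dw Dxvw Ex.
(* The perturbation lowers the order of mu(G) from j + 2 to j + 1 and leaves that of mu(G - v - w)
   at j. Their product has odd order 2j + 1, while the other product has order at least 2j + 2. *)
have := weighted_Heilmann_Lieb theta (@perturbed_rec x) vG wG nvw.
move=> /locally_sosB_if.
rewrite /perturbed !inE nxv nxw xG /= (setD1C G v x) (setD1C G w x).
rewrite (setD1C (G :\ v) w x) (setD1C G v x).
have [a1 ja1] := jet_le_mup gv; have [a2 ja2] := jet_le_mup lxv.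
have [b1 jb1] := jet_le_mup gw; have [b2 jb2] := jet_le_mup lxw.
have j1 := jetM (jetD ja1 ja2) (jetD jb1 jb2).
have jG : jet theta (mu G) j.+1 0 by apply: jet_lt_mup; rewrite -/(m _) EG.
have [c c0] := mult_jet e_sym e_irr theta (G :\ x); rewrite Ejx => jx.
have [d d0] := mult_jet e_sym e_irr theta (G :\ v :\ w); rewrite -/j => jvw.
have j2 := jetM (jetD jG jx) (jetD jvw (jet_lt_mup gxvw)).
have lt_j : (j.+1 + j < j.+1 + j.+1)%N by rewrite ltn_add2l.
move=> /locally_sos_odd /(_ _ (jetB (jet_low lt_j j1) j2)) E.
have /eqP : 0 - (0 + c) * (d + 0) = 0 by apply: E; rewrite addSn /= addnn odd_double.
by rewrite !add0r addr0 oppr_eq0 mulf_eq0 (negbTE c0) (negbTE d0).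
Qed.

(** The derivative is the sum of all mu(S - u) and has order exactly m(S) - 1, so some summand does
    not vanish to order m(S). *)
Lemma essential_exists S : (0 < m S)%N -> exists2 u, u \in S & (m (S :\ u)).+1 = m S.
Proof.
case Em : (m S) => [//|k] _.
have [/existsP [u /andP [uS /eqP Eu]] | /existsPn ne] :=
  boolP [exists u, (u \in S) && (m (S :\ u) == k)]; first by exists u; rewrite ?Eu.
have [c c0] := mult_jet e_sym e_irr theta S; rewrite Em => jS.
have := jet_eps (jet_deriv jS); rewrite deriv_matchpoly // => /jet_inj E.
have /eqP : k.+1%:R * c = \sum_(u in S) 0.
  apply: E; apply: jet_sum => u uS; apply: jet_lt_mup; rewrite -/(m _).
  by have := ne u; rewrite uS; have := mult_leD1 e_sym e_irr theta S u; lia.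
by rewrite big1_eq mulf_eq0 pnatr_eq0 (negbTE c0).
Qed.

(** If x were essential in S - z, it would be parallel there to every other neighbour of z, hence
    these would be parallel to one another; but the essential neighbour w of z has a nonparallel
    neighbour v of z. *)
Lemma stability_ness S z x : spec S z -> x \in S -> x != z -> ~~ ess S x ->
  (m (S :\ z) <= m (S :\ z :\ x))%N.
Proof.
move=> sz xS nxz nx; rewrite leqNgt; apply/negP => gt_x.
have /specP [zS nz [w [ew ezw]]] := sz; have Ez := spec_positive sz.
have nxw := ness_neq nx ew; have nzw := ness_neq nz ew.
have /andP [wS /eqP Ew] := ew; set j := m (S :\ w) in Ew.
have D1 G u := mult_leD1 e_sym e_irr theta G u.
have Ezx : m (S :\ z :\ x) = j.+1 by have := D1 (S :\ z) x; clear -gt_x Ez Ew; lia.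
have lx : (j < m (S :\ x))%N by rewrite Ew ness_mult.
have lzw : (j < m (S :\ z :\ w))%N by have := D1 (S :\ z) w; rewrite Ez -Ew.
(* In the recurrence of mu(S - x) at z, the coefficients of order j sum to 0. Multiplied by c they
   are all nonnegative, so each is 0. *)
have nbr v : v \in S :\ x :\ z -> e z v -> (j < m (S :\ x :\ z :\ v))%N.
  have [c c0] := mult_jet e_sym e_irr theta (S :\ x :\ z).
  rewrite (setD1C S x z) Ezx => jzx.
  pose d v := (mu (S :\ z :\ x :\ v) %/ ('X - theta%:P) ^+ j).[theta].
  have jd u : jet theta (mu (S :\ z :\ x :\ u)) j (d u).
    by apply: jet_divp; have := D1 (S :\ z :\ x) u; rewrite Ezx ltnS.
  have zSx : z \in S :\ x by rewrite !inE eq_sym nxz.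
  have d_ge0 u : u \in S :\ z :\ x -> 0 <= c * d u.
    move=> uS; have := D1 (S :\ z :\ x) u; rewrite Ezx ltnS leq_eqVlt.
    case/predU1P => [Eu | gt_u]; last first.
      by rewrite (jet_inj (jd u) (jet_lt_mup gt_u)) mulr0.
    have [-> | du0] := eqVneq (d u) 0; first by rewrite mulr0.
    have jdu : jet theta (mu (S :\ z :\ x :\ u)) (m (S :\ z :\ x :\ u)) (d u).
      by rewrite -Eu.
    have Eu' : (m (S :\ z :\ x :\ u)).+1 = m (S :\ z :\ x) by rewrite Ezx Eu.
    rewrite -Ezx in jzx.
    exact: ltW (essential_jet_sign e_sym e_irr uS Eu' jzx jdu c0 du0).
  have sum0 : \sum_(u in S :\ z :\ x | e z u) d u = 0.
    have jx := jet_lt_mup lx.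
    have jzx0 := jetMl 'X (jet_low (ltnSn j) jzx).
    have js := jet_sum (fun u (_ : (u \in S :\ z :\ x) && e z u) => jd u).
    have := jetB jzx0 js; rewrite mulr0 sub0r.
    rewrite -(setD1C S x z) -(matchpoly_rec e_sym e_irr R zSx)
            (setD1C S x z) => /(jet_inj jx).
    by move/eqP; rewrite eq_sym oppr_eq0 => /eqP.
  move=> vS ezv; apply: mup_gt_jet; first exact: matchpoly_neq0.
  suff <- : d v = 0 by [].
  have /psumr_eq0P : forall u, (u \in S :\ z :\ x) && e z u -> 0 <= c * d u.
    by move=> u /andP [/d_ge0].
  rewrite -mulr_sumr sum0 mulr0 => /(_ erefl v); rewrite vS ezv => /(_ isT)/eqP.
  by rewrite mulf_eq0 (negbTE c0) => /eqP.
(* Otherwise the recurrence at z would make mu(S - w) vanish to order above j. *)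
have [v vS /andP [ezv le_v]] : exists2 v, v \in S :\ w :\ z
    & e z v && (m (S :\ w :\ z :\ v) <= j)%N.
  apply/exists_inP; apply: contraT => /exists_inPn ge_v.
  have zSw : z \in S :\ w by rewrite !inE nzw.
  suff : (j < m (S :\ w))%N by rewrite ltnn.
  apply: mup_gt_jet; first exact: matchpoly_neq0.
  rewrite (matchpoly_rec e_sym e_irr R zSw).
  have j1 : jet theta (mu (S :\ w :\ z)) j 0.
    by apply: jet_lt_mup; rewrite (setD1C S w z).
  have j2 : jet theta (\sum_(v in S :\ w :\ z | e z v) mu (S :\ w :\ z :\ v)) j
              (\sum_(v in S :\ w :\ z | e z v) 0).
    apply: jet_sum => v /andP [vS ezv]; apply: jet_lt_mup.
    by have := ge_v _ vS; rewrite ezv /= -ltnNge.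
  by have := jetB (jetMl 'X j1) j2; rewrite big1_eq mulr0 subr0.
rewrite (setD1C S w z) in vS le_v.
have wSzx : w \in S :\ x :\ z by rewrite !inE eq_sym nzw eq_sym nxw.
have nvx : v != x.
  apply: contraTneq le_v => ->; rewrite -ltnNge setD1C -(setD1C S x z).
  exact: nbr.
have [nvw nvz vS0] : [/\ v != w, v != z & v \in S] by move: vS; rewrite !inE => /and3P [].
have vSxz : v \in S :\ x :\ z by rewrite !inE nvx nvz.
have := nbr _ vSxz ezv; have := nbr _ wSzx ezw; rewrite (setD1C S x z) => lw lv.
have := @parallel_trans (S :\ z) x v w.
rewrite !inE nxz nvz (eq_sym w z) nzw xS vS0 wS (eq_sym x v) nvx nxw nvw.
move=> /(_ isT isT isT isT isT isT); rewrite (setD1C (S :\ z) v w).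
by clear -Ez Ew Ezx lw lv le_v; lia.
Qed.

(** Interlacing decides the cases x essential and x neutral, the latter with [stability_ness]; for x
    positive, parity excludes the lower value. *)
Lemma stability S z x : spec S z -> x \in S -> x != z ->
  m (S :\ x :\ z) = (m (S :\ x)).+1.
Proof.
move=> sz xS nxz; have Ez := spec_positive sz.
have /specP [zS _ _] := sz.
have D1 := mult_leD1 e_sym e_irr theta (S :\ z) x.
have D2 := mult_D1le e_sym e_irr theta (S :\ x) z.
rewrite (setD1C S x z) in D2 *; have [/andP [_ /eqP Ex] | nx] := boolP (ess S x).
  lia.
have lx := ness_mult xS nx; have lzx := stability_ness sz xS nxz nx.
have Dx := mult_D1le e_sym e_irr theta S x.
have := @mult_parity2 _ _ e_sym e_irr _ theta S z x (m S) zS xS.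
rewrite eq_sym => /(_ nxz); have [Ex|] := eqVneq (m (S :\ x)) (m S); lia.
Qed.

Lemma spec_D1 S a u : spec S a -> u \in S -> u != a -> ~~ ess S u -> spec (S :\ u) a.
Proof.
move=> sa uS nua nu; have Ea := stability sa uS nua.
have /specP [aS na [w [ew eaw]]] := sa; apply/specP; split.
- by rewrite !inE eq_sym nua.
- by rewrite /ess Ea; clear; lia.
by exists w; split=> //; apply: ess_D1.
Qed.

(** Special vertices are deleted one at a time; by [spec_D1] the others stay special. *)
Lemma mult_D_spec S X : (forall a, a \in X -> spec S a) ->
  m (S :\: X) = (m S + #|X|)%N /\
  (forall u, u \in S :\: X -> m ((S :\: X) :\ u) = (m (S :\ u) + #|X|)%N).
Proof.
have [n] := ubnP #|X|; elim: n S X => // n IHn S X lt_n sX.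
have [-> | [a aX]] := set_0Vmem X.
  by rewrite setD0 cards0 addn0; split=> // u _; rewrite addn0.
have cX : #|X| = #|X :\ a|.+1 by rewrite (cardsD1 a X) aX.
have sa := sX _ aX; have Ea := spec_positive sa; have /specP [aS na _] := sa.
have -> : S :\: X = (S :\ a) :\: (X :\ a).
  apply/setP => y; rewrite !inE negb_and negbK.
  by case: eqP => [-> | _] //=; rewrite aX.
have [||E1 E2] := IHn (S :\ a) (X :\ a); first lia.
  move=> b /setD1P [nba bX]; apply: spec_D1 => //; first exact: sX.
  by rewrite eq_sym.
split=> [|u uS]; first by rewrite E1; lia.
rewrite E2 // setD1C stability //; first lia.
  by move: uS; rewrite !inE => /and3P [].
by move: uS; rewrite !inE => /and3P [].
Qed.

Lemma mult_D_le S X : (m (S :\: X) <= m S + #|X|)%N.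
Proof.
have [n] := ubnP #|X|; elim: n X => // n IHn X lt_n.
have [-> | [a aX]] := set_0Vmem X; first by rewrite setD0 leq_addr.
have cX : #|X| = #|X :\ a|.+1 by rewrite (cardsD1 a X) aX.
have -> : S :\: X = (S :\: (X :\ a)) :\ a.
  apply/setP => y; rewrite !inE negb_and negbK.
  by case: eqP => [-> | _] //=; rewrite aX.
have := mult_D1le e_sym e_irr theta (S :\: (X :\ a)) a.
have := IHn (X :\ a); lia.
Qed.

End Stability.

(** * Additivity of multiplicities over components *)

Section Components.
Variables (T : finType) (e : rel T).
Hypotheses (e_sym : symmetric e) (e_irr : irreflexive e).
Variables (R : realFieldType) (theta : R).
Implicit Types (S H C D X : {set T}) (u v w x y : T).
Local Notation m := (mult e theta).

Lemma erest_connect_sym H : connect_sym (erest e H).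
Proof. by apply: sym_connect_sym => x y; rewrite /erest /= e_sym andbCA. Qed.

Lemma comp_of_id H x : x \in H -> x \in comp_of e H x.
Proof. by move=> xH; rewrite inE xH connect0. Qed.

Lemma comp_of_sub H x : comp_of e H x \subset H.
Proof. by apply/subsetP => y; rewrite inE => /andP []. Qed.

Lemma comp_ofE H C u : is_comp e H C -> u \in C -> C = comp_of e H u.
Proof.
move=> [x xH ->]; rewrite inE => /andP [uH xu]; apply/setP => y.
by rewrite !inE (same_connect (erest_connect_sym H) xu).
Qed.

Lemma comp_of_closed H x y z :
  y \in comp_of e H x -> z \in H :\: comp_of e H x -> ~~ e y z.
Proof.
rewrite !inE => /andP [yH xy] /andP [nz zH]; apply: contraNN nz => eyz.
by rewrite zH /=; apply: connect_trans xy (connect1 _); rewrite /erest /= yH zH.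
Qed.

(** The arbitrary [X] lets one splitting serve H, H - u, H - v and H - u - v. *)
Lemma mult_comp_of H x X :
  m (H :\: X) = (m (comp_of e H x :\: X) + m ((H :\: comp_of e H x) :\: X))%N.
Proof.
set C := comp_of e H x; have sCH := comp_of_sub H x; rewrite -multU //.
- congr m; apply/setP => y; have := subsetP sCH y; rewrite -/C !(in_setU, in_setD).
  by case: (y \in C) => [-> //|_] /=; rewrite andbF ?orbF.
- rewrite -setI_eq0; apply/eqP/setP => y.
  by rewrite in_setI !in_setD in_set0; case: (y \in C); rewrite /= !andbF.
move=> y z /setDP [yC _] /setDP [zHC _]; exact: comp_of_closed yC zHC.
Qed.

(* A component of H on which theta is a root contains an essential vertex,
   and along its edges essentiality can only stop at a special vertex. *)
Lemma comp_of_mult0 H x : x \in H -> ~~ ess e theta H x ->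
  (forall a, ~~ spec e theta H a) -> m (comp_of e H x) = 0%N.
Proof.
move=> xH nx nspec; set C := comp_of e H x; apply/eqP; rewrite -leqn0 leqNgt.
apply: contra nx => /(essential_exists e_sym e_irr) [w wC Ew].
have wH := subsetP (comp_of_sub H x) _ wC.
have ew : ess e theta H w.
  have := mult_comp_of H x set0; rewrite !setD0 => split0.
  rewrite /ess wH (mult_comp_of H x) split0 -/C -Ew addSn.
  by rewrite (@setD1_notin _ (H :\: C)) ?eqxx // in_setD wC.
have cl : closed (erest e H) [pred y | ess e theta H y].
  apply: (intro_closed (erest_connect_sym H)) => y z.
  move=> /and3P [yH zH eyz]; rewrite !inE => ey.
  apply: contraT => nz; have /negP [] := nspec z.
  by apply/specP; split=> //; exists y; rewrite e_sym.
have := closed_connect cl (x := x) (y := w).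
rewrite !inE ew => -> //.
by move: wC; rewrite inE => /andP [].
Qed.

End Components.

(** * Characterization of the edges of D *)

Theorem theorem5p18 (T : finType) (e : rel T)
    (e_sym : symmetric e) (e_irr : irreflexive e)
    (R : rcfType) (theta : R) (u v : T) :
  u != v ->
  Dedge e theta u v <->
  [\/ u \in Bset e theta \/ v \in Bset e theta,
      [/\ u \in Nset e theta, v \in Nset e theta &
          exists C1 C2 : {set T},
            [/\ is_comp e (~: Aset e theta) C1, is_comp e (~: Aset e theta) C2,
                mult e theta C1 = 0%N, mult e theta C2 = 0%N &
                [/\ u \in C1, v \in C2 & C1 != C2]]]
    | exists C : {set T},
        [/\ is_comp e (~: Aset e theta) C, mult e theta C = 0%N,
            u \in C, v \in C & mult e theta (C :\ u :\ v) = 0%N]].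
Proof.
move=> nuv; pose G := [set: T]; pose m := mult e theta.
pose A := Aset e theta; pose H := ~: A.
have setC1T x : [set~ x] = G :\ x by apply/setP => y; rewrite !inE andbT.
have EH : H = G :\: A by rewrite setTD.
have essE x : (x \in Bset e theta) = ess e theta G x.
  by rewrite inE /essential /ess setC1T inE.
have specE a : (a \in A) = spec e theta G a.
  rewrite inE /spec inE /= -essE inE; congr (_ && _).
  by apply: eq_existsb => w; rewrite -essE inE.
have neuE x : (x \in Nset e theta) = (m (G :\ x) == m G).
  by rewrite inE /neutral setC1T.
have -> : Dedge e theta u v = (m (G :\ u :\ v) <= m G)%N.
  rewrite /Dedge nuv; congr (m _ <= _)%N.
  by apply/setP => y; rewrite !inE andbT negb_or andbC.
rewrite !essE !neuE.
have D1 := mult_leD1 e_sym e_irr theta; have D2 := mult_D1le e_sym e_irr theta.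
have [eu | nu] := boolP (ess e theta G u).
  split=> [_ | _]; first by constructor 1; left.
  case/andP: eu => _ /eqP; rewrite -/m => <-; exact: D2.
have [ev | nv] := boolP (ess e theta G v).
  split=> [_ | _]; first by constructor 1; right.
  case/andP: ev => _ /eqP; rewrite -/m => <-; rewrite setD1C; exact: D2.
have uG : u \in G by rewrite inE.
have vG : v \in G by rewrite inE.
have specA a : a \in A -> spec e theta G a by rewrite specE.
have [mH mHD1] := mult_D_spec e_sym e_irr specA; rewrite -EH -/m in mH mHD1.
(* Deleting A shifts m(G) and m(G - x) by the same amount, so essentiality is unchanged and H has no
   special vertices. *)
have essH x : x \in H -> ess e theta H x = ess e theta G x.
  by move=> xH; rewrite /ess xH inE -/m mH mHD1 //= -addSn eqn_add2r.
have nspecH a : ~~ spec e theta H a.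
  apply/negP => /specP [aH na [w [ew eaw]]].
  have wH : w \in H by case/andP: ew.
  have : a \in A.
    rewrite specE; apply/specP.
    by split; rewrite ?inE -?essH //; exists w; rewrite -essH.
  by apply/negP; move: aH; rewrite inE.
have comp0 x : x \in H -> ~~ ess e theta G x -> m (comp_of e H x) = 0%N.
  by move=> xH nx; apply: comp_of_mult0; rewrite // essH.
have split X : m (H :\: X) =
    (m (comp_of e H u :\: X) + m (H :\: comp_of e H u :\: X))%N by apply: mult_comp_of.
have mH0 : u \in H -> m H = m (H :\: comp_of e H u).
  by move=> uH; have := split set0; rewrite !setD0 comp0.
have sameC : u \in H -> v \in comp_of e H u ->
    m (H :\ u :\ v) = (m (comp_of e H u :\ u :\ v) + m H)%N.
  move=> uH vC; rewrite !setDDl split mH0 //; congr (_ + m _)%N.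
  by rewrite -setDDl (@setD1_notin _ _ u) ?setD1_notin ?in_setD ?vC ?comp_of_id.
have diffC : u \in H -> v \in H -> v \notin comp_of e H u ->
    (m (H :\ u :\ v) + m H)%N = (m (H :\ u) + m (H :\ v))%N.
  move=> uH vH vC; set C := comp_of e H u in vC.
  have uC : u \in C by rewrite comp_of_id.
  rewrite !setDDl !split mH0 // -/C.
  rewrite -!setDDl (@setD1_notin _ (C :\ u)) ?in_setD1 ?(negbTE vC) ?andbF //.
  rewrite (@setD1_notin _ C v) // (@setD1_notin _ (H :\: C) u) ?in_setD ?uC //.
  by rewrite [m C]comp0 // add0n addnAC.
have DHA : G :\ u :\ v :\: A = H :\ u :\ v.
  by apply/setP => y; rewrite EH !inE; do ![case: (_ == _)]; rewrite //= andbF.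
have lu : (m G <= m (G :\ u))%N by apply: ness_mult.
have lv : (m G <= m (G :\ v))%N by apply: ness_mult.
have edge_H : (m (G :\ u :\ v) <= m G)%N <->
    [/\ u \in H, v \in H & m (H :\ u :\ v) <= m H]%N.
  split=> [le_uv | [uH vH le_uv]].
    have uH : u \in H.
      rewrite inE specE; apply/negP => su.
      have := stability e_sym e_irr su vG; rewrite eq_sym => /(_ nuv).
      by rewrite setD1C -/m; clear -le_uv lv; lia.
    have vH : v \in H.
      rewrite inE specE; apply/negP => sv.
      have := stability e_sym e_irr sv uG nuv.
      by rewrite -/m; clear -le_uv lu; lia.
    (* In this direction an upper bound suffices: deleting A raises m(G - u - v) by at most |A|. *)
    split=> //; rewrite -DHA mH; apply: leq_trans (mult_D_le e_sym e_irr theta _ _) _.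
    by rewrite leq_add2r.
  have neqA x a : x \in H -> a \in A -> x != a.
    by rewrite inE => xA aA; apply: contraNneq xA => ->.
  have spec_u a : a \in A -> spec e theta (G :\ u) a.
    by move=> aA; apply: spec_D1 => //; [apply: specA | apply: neqA].
  (* If v is essential in G - u, then m(G - u - v) = m(G - u) - 1, which is at most m(G). *)
  have [/andP [_ /eqP Ev] | nv'] := boolP (ess e theta (G :\ u) v).
    by rewrite -ltnS /m Ev D2.
  have spec_uv a : a \in A -> spec e theta (G :\ u :\ v) a.
    move=> aA; apply: spec_D1 => //; [exact: spec_u | | exact: neqA].
    by rewrite !inE eq_sym nuv.
  have [E _] := mult_D_spec e_sym e_irr spec_uv.
  by rewrite DHA -/m in E; rewrite E mH leq_add2r in le_uv.
rewrite edge_H; split=> [[uH vH le_uv] | [[] // | | ]].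
- have [vC | vC] := boolP (v \in comp_of e H u).
    constructor 3; exists (comp_of e H u); split=> //; first by exists u.
    + exact: comp0.
    + exact: comp_of_id.
    by apply/eqP; rewrite sameC // -[leqRHS]add0n leq_add2r leqn0 in le_uv.
  (* The edge condition becomes m(G - u) + m(G - v) <= 2 m(G), so the nonessential vertices u and v
     are both neutral. *)
  have := diffC uH vH vC; rewrite !mHD1 // mH => E.
  have [Eu Ev] : m (G :\ u) = m G /\ m (G :\ v) = m G.
    by rewrite mH in le_uv; clear -le_uv E lu lv; split; lia.
  constructor 2; rewrite Eu Ev !eqxx; split=> //.
  exists (comp_of e H u), (comp_of e H v); split; rewrite ?comp_of_id //.
  - by exists u.
  - by exists v.
  - exact: comp0.
  - exact: comp0.
  by split=> //; apply: contraNneq vC => ->; rewrite comp_of_id.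
- move=> [/eqP Eu /eqP Ev [C1 [C2 [K1 K2 _ _ [uC1 vC2 nC]]]]].
  have uH : u \in H by case: K1 uC1 => x _ ->; apply/subsetP/comp_of_sub.
  have vH : v \in H by case: K2 vC2 => x _ ->; apply/subsetP/comp_of_sub.
  have vC : v \notin comp_of e H u.
    apply: contraNN nC => vC; rewrite (comp_ofE e_sym K1 uC1) (comp_ofE e_sym K2 vC2).
    by apply/eqP/comp_ofE => //; exists u.
  have := diffC uH vH vC; rewrite !mHD1 // mH Eu Ev => /eqP.
  by rewrite eqn_add2r => /eqP ->.
move=> [C [K _ uC vC E]].
have uH : u \in H by case: K uC => x _ ->; apply/subsetP/comp_of_sub.
have vH : v \in H by case: K vC => x _ ->; apply/subsetP/comp_of_sub.
by move: vC E; rewrite (comp_ofE e_sym K uC) => vC E; split=> //; rewrite sameC // /m E.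
Qed.
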